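(* Let $G$ be a finite abelian group. Then $r_i(G)=0$ for every integer $i>1$.
   Context: Let $G$ be a finite group with identity $1$, and write $[k,g]=kgk^{-1}g^{-1}$. Define $G(1)=\{(g,k)\in G\times G : [k,g]=1\}$. For an integer $n\ge 2$, let $G(n)$ be the set of minimal sequences of degree $n$, i.e. the set of all $(g_1,k_1,g_2,k_2,\dots,g_n,k_n)\in G^{2n}$ such that $\prod_{i=1}^n [k_i,g_i]=1$ and, for every $r$ with $1\le r\le n-1$, $\prod_{j=1}^r[k_j,g_j]\neq 1$ and $\prod_{j=r+1}^n[k_j,g_j]\neq 1$. Let $\mathcal{G}(n)$ be the graph with vertex set $G(n)$ in which two elements of $G(n)$ are joined by an edge when one is obtained from the other by one of the following replacements (all other entries unchanged): 1) for one index $i\in\{1,\dots,n\}$, replace $(g_i,k_i)$ by (a) $(g_i,k_ig_i^m)$ for some $m\in\mathbb{Z}$, or (b) $(g_ik_ig_i^{-1},g_i^{-1})$; 2) for two consecutive indices $i,i+1$, replace $(g_i,k_i,g_{i+1},k_{i+1})$ by (a) $([g_i,k_i]g_{i+1},\,k_{i+1},\,k_{i+1}g_ik_{i+1}^{-1},\,k_{i+1}k_ik_{i+1}^{-1})$, or (b) $(k_i^{-1}g_{i+1}k_i,\,k_i^{-1}k_{i+1}k_i,\,k_i^{-1}[k_i,g_i]k_ig_i,\,k_i)$. The number $r_n(G)$ is the number of connected components of the graph $\mathcal{G}(n)$ (so $r_n(G)=0$ if $G(n)$ is empty). *)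

(* Defs.v *)
From mathcomp Require Import all_boot ssrint all_fingroup.
From mathcomp Require Import boolp.

Set Implicit Arguments.
Unset Strict Implicit.
Unset Printing Implicit Defensive.

Local Open Scope group_scope.

(* The convention here is [k, g] = k g k^-1 g^-1, whereas the library's
   [~ k, g] is k^-1 g^-1 k g. *)
Definition comm (gT : finGroupType) (k g : gT) : gT := k * g * k^-1 * g^-1.

Definition expgz (gT : finGroupType) (g : gT) (m : int) : gT :=
  match m with
  | Posz a => g ^+ a
  | Negz a => g ^- a.+1
  end.

(* A sequence (g_1, k_1, ..., g_n, k_n) is the function i |-> (g_i, k_i), with
   indices shifted to 0, ..., n - 1. *)
Definition gkseq (gT : finGroupType) (n : nat) := {ffun 'I_n -> gT * gT}.

Definition comm_at (gT : finGroupType) (n : nat) (x : gkseq gT n) (i : 'I_n) :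
  gT := comm (x i).2 (x i).1.

(* For n = 1 the condition on r is void, so this is
   {(g, k) | [k, g] = 1}. *)
Definition minimal_seqs (gT : finGroupType) (G : {group gT}) (n : nat) :
  {set gkseq gT n} :=
  [set x : gkseq gT n |
    [&& x \in ffun_on (setX G G),
        \prod_(i < n) comm_at x i == 1
      & [forall r : 'I_n, (0 < r) ==>
           (\prod_(j < n | j < r) comm_at x j != 1)
             && (\prod_(j < n | r <= j) comm_at x j != 1)]]].

Definition replace1 (gT : finGroupType) (n : nat) (x : gkseq gT n)
  (i : 'I_n) (p : gT * gT) : gkseq gT n :=
  [ffun l => if l == i then p else x l].

Inductive move (gT : finGroupType) (n : nat) (x : gkseq gT n) :
  gkseq gT n -> Prop :=
| Move1a (i : 'I_n) (g k : gT) (m : int) :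
    x i = (g, k) ->
    move x (replace1 x i (g, k * expgz g m))
| Move1b (i : 'I_n) (g k : gT) :
    x i = (g, k) ->
    move x (replace1 x i (g * k * g^-1, g^-1))
| Move2a (i j : 'I_n) (g k g' k' : gT) :
    j = i.+1 :> nat -> x i = (g, k) -> x j = (g', k') ->
    move x (replace1 (replace1 x i (comm g k * g', k'))
                     j (k' * g * k'^-1, k' * k * k'^-1))
| Move2b (i j : 'I_n) (g k g' k' : gT) :
    j = i.+1 :> nat -> x i = (g, k) -> x j = (g', k') ->
    move x (replace1 (replace1 x i (k^-1 * g' * k, k^-1 * k' * k))
                     j (k^-1 * comm k g * k * g, k)).

(* A move need not preserve minimality: an edge requires both ends to be
   minimal sequences. *)
Definition edge (gT : finGroupType) (G : {group gT}) (n : nat) :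
  rel (gkseq gT n) :=
  [rel x y | [&& x \in minimal_seqs G n, y \in minimal_seqs G n
               & `[< move x y \/ move y x >]]].

Definition rnum (gT : finGroupType) (G : {group gT}) (n : nat) : nat :=
  n_comp (@edge gT G n) (minimal_seqs G n).

(* The conditions under which n_comp counts connected components. *)
Lemma edge_connect_sym (gT : finGroupType) (G : {group gT}) (n : nat) :
  connect_sym (@edge gT G n).
Proof.
apply: sym_connect_sym => x y; rewrite /edge /= andbCA; do 2!congr andb.
by apply: asbool_equiv_eq; split=> -[]; [right | left | right | left].
Qed.

Lemma edge_closed (gT : finGroupType) (G : {group gT}) (n : nat) :
  closed (@edge gT G n) (minimal_seqs G n).
Proof. by move=> x y /and3P[-> ->]. Qed.

(* Main.v *)
Require Import Defs.
From mathcomp Require Import all_boot all_fingroup.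

(** In an abelian group all commutators are trivial, so every partial product is 1. Minimality
    forbids this as soon as a proper cut exists, so for [1 < n] the graph has no vertices, hence no
    components. *)

Lemma comm_abelian (gT : finGroupType) (G : {group gT}) (k g : gT) :
  abelian G -> k \in G -> g \in G -> comm k g = 1%g.
Proof.
move=> abG Gk Gg.
by rewrite /comm (centsP abG k Gk g Gg) mulgK mulgV.
Qed.

Lemma minimal_seqs_abelian (gT : finGroupType) (G : {group gT}) (n : nat) :
  abelian G -> 1 < n -> minimal_seqs G n = set0.
Proof.
move=> abG n_gt1; apply/setP => x; rewrite !inE.
(* [Ordinal n_gt1] is the cut r = 1, available because [1 < n]; its left product is the first
   commutator alone. *)
apply/and3P => -[/ffun_onP Gx _ /forallP/(_ (Ordinal n_gt1))/= /andP[/eqP prod1_neq1 _]].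
apply: prod1_neq1; apply: big1 => j _; have := Gx j; rewrite inE => /andP[Gg Gk].
exact: comm_abelian abG Gk Gg.
Qed.

Theorem lemma2 (gT : finGroupType) (G : {group gT}) (abG : abelian G)
  (i : nat) (hi : 1 < i) : rnum G i = 0.
Proof.
rewrite /rnum minimal_seqs_abelian //.
by apply: eq_card0 => x; rewrite !inE andbF.
Qed.
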